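(* Let $\beta\in S_n$ have cycle type $(c_1,\dots,c_n)$. Then the number $c(3,\beta)$ of $\alpha\in S_n$ with $H(\alpha\beta,\beta\alpha)=3$ equals \[ c(3,\beta)=\Big(\sum_{\ell=3}^{n}c_\ell\binom{\ell}{3}+\sum_{1\le\ell<m\le n}\ell m\,c_\ell c_m\Big)|C_{S_n}(\beta)|. \]
   Context: $S_n$ is the symmetric group on $[n]$, products composed right to left; $H(\sigma,\tau)=|\{a:\sigma(a)\ne\tau(a)\}|$ is the Hamming metric. The cycle type $(c_1,\dots,c_n)$ means $\beta$ has exactly $c_i$ cycles of length $i$ (fixed points counted as $1$-cycles). $C_{S_n}(\beta)$ is the centralizer of $\beta$, of order $\prod_i i^{c_i}c_i!$. *)

(* Defs.v *)
From mathcomp Require Import all_boot all_fingroup.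

Set Implicit Arguments.
Unset Strict Implicit.
Unset Printing Implicit Defensive.

(* [perm_comp s t] is the right-to-left product: it maps [a] to [s (t a)],
   whereas the group law of ['S_n] composes left to right. *)
Definition perm_comp (n : nat) (s t : 'S_n) : 'S_n := (t * s)%g.

Lemma perm_compE (n : nat) (s t : 'S_n) (a : 'I_n) :
  perm_comp s t a = s (t a).
Proof. exact: permM. Qed.

Definition hamming (n : nat) (s t : 'S_n) : nat := #|[set a | s a != t a]|.

(* [c i] is c_i; the values of [c] outside 1, ..., n are irrelevant.
   Fixed points are singleton orbits, hence counted as 1-cycles. *)
Definition has_cycle_type (n : nat) (beta : 'S_n) (c : nat -> nat) : Prop :=
  forall i : nat, 1 <= i <= n -> #|[set O in porbits beta | #|O| == i]| = c i.

Definition num_k_commuting (n k : nat) (beta : 'S_n) : nat :=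
  #|[set alpha : 'S_n |
      hamming (perm_comp alpha beta) (perm_comp beta alpha) == k]|.

(* Main.v *)
Require Import Defs.
From mathcomp Require Import all_boot all_fingroup zify.

(** Since [H(alpha beta, beta alpha)] is the distance from [beta] to its conjugate
[beta ^ alpha], the count is [#|'C[beta]|] times the number of conjugates [u] of
[beta] at distance 3 from [beta].  Such a [u] is [beta] precomposed with a
3-cycle [(a b c)], and marking one of its three moved points turns [u] into an
ordered triple [(a, b, c)]; so three times the number of such [u] is the number
of triples for which the product is again conjugate to [beta].  Multiplying by
the two transpositions one at a time splits or merges orbits, and the cycle type
is preserved in exactly two situations: [a], [b], [c] lie in this cyclic order
on a common cycle (split, then merge back), or, up to rotating the triple, [a]
and [b] lie on a cycle of length [l], [c] on one of length [m < l], and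
[a = beta^m b] (the cycle of length [l] is cut into pieces of lengths [m] and
[l - m], and the latter is glued to the cycle of [c]). *)

Set Implicit Arguments.
Unset Strict Implicit.
Unset Printing Implicit Defensive.

(** * Positions of points along an orbit *)

Section PermutationOrbits.
Variable T : finType.
Implicit Types (s u : {perm T}) (x y z a b c : T).
Local Open Scope group_scope.

(* Equal to [#|porbit s x|] when [y] is outside the orbit of [x]. *)
Definition porbit_index s x y := index y (traject s x #|porbit s x|).

Lemma card_porbit_gt0 s x : 0 < #|porbit s x|.
Proof. by rewrite lt0n card_porbit_neq0. Qed.

Lemma porbit_index_lt s x y :
  (porbit_index s x y < #|porbit s x|) = (y \in porbit s x).
Proof. by rewrite porbit_traject -index_mem size_traject. Qed.

Lemma porbit_indexK s x y :
  y \in porbit s x -> (s ^+ porbit_index s x y) x = y.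
Proof.
move=> sy; rewrite permX -(nth_traject s (n := #|porbit s x|)) ?porbit_index_lt //.
by rewrite nth_index // -porbit_traject.
Qed.

Lemma porbit_index_exp s x i :
  i < #|porbit s x| -> porbit_index s x ((s ^+ i) x) = i.
Proof.
move=> lt_i; rewrite /porbit_index permX -(nth_traject s lt_i).
by rewrite index_uniq ?size_traject ?uniq_traject_porbit.
Qed.

Lemma porbit_index0 s x y : (porbit_index s x y == 0%N) = (y == x).
Proof.
apply/eqP/eqP=> [xy0|->]; last first.
  by have := porbit_index_exp (card_porbit_gt0 s x); rewrite expg0 perm1.
by rewrite -(@porbit_indexK s x y) -?porbit_index_lt xy0 ?card_porbit_gt0 // expg0 perm1.
Qed.

Lemma big_porbit (F : T -> nat) s x :
  \sum_(y in porbit s x) F y = \sum_(i < #|porbit s x|) F ((s ^+ i) x).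
Proof.
rewrite (reindex_onto (fun i : 'I_#|porbit s x| => (s ^+ i) x)
  (fun y => insubd (Ordinal (card_porbit_gt0 s x)) (porbit_index s x y))).
  apply: eq_bigl => i; rewrite mem_porbit /=; apply/eqP/val_inj.
  by rewrite val_insubd porbit_index_exp ?ltn_ord.
by move=> y sxy; rewrite val_insubd porbit_index_lt sxy porbit_indexK.
Qed.

Lemma porbit_exp_card s x : (s ^+ #|porbit s x|) x = x.
Proof. by rewrite permX iter_porbit. Qed.

Lemma porbit_eq s x y : y \in porbit s x -> porbit s y = porbit s x.
Proof. by move=> sy; apply/eqP; rewrite eq_porbit_mem. Qed.

Lemma disjoint_porbit s x y :
  y \notin porbit s x -> [disjoint porbit s x & porbit s y].
Proof.
move=> sxy; apply/pred0P=> z /=; apply/negbTE; apply: contra sxy => /andP[zx zy].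
by rewrite -(porbit_eq zx) (porbit_eq zy) porbit_id.
Qed.

(** * Splitting and merging orbits by a transposition *)

Lemma porbit_tperm_out s x y z :
  x \notin porbit s z -> y \notin porbit s z ->
  porbit (tperm x y * s) z = porbit s z.
Proof.
move=> sxz syz.
suffices exp_id n: ((tperm x y * s) ^+ n) z = (s ^+ n) z.
  by apply/setP => u; apply/porbitP/porbitP => -[i ->]; exists i; rewrite exp_id.
elim: n => // n IHn; rewrite !expgSr !permM {}IHn tpermD //.
  by apply: contraNneq sxz => ->; apply: mem_porbit.
by apply: contraNneq syz => ->; apply: mem_porbit.
Qed.

(** From [y = s^k x] the product jumps to [s x] and then follows [s], meeting neither [x] nor [y]
    again before it comes back to [y] after [k] steps. *)
Lemma exp_tperm_cut s x k i : k < #|porbit s x| -> i < k ->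
  ((tperm x ((s ^+ k) x) * s) ^+ i.+1) ((s ^+ k) x) = (s ^+ i.+1) x.
Proof.
move=> lt_k; elim: i => [|i IHi] lt_i.
  by rewrite !expg1 permM tpermR.
have lt_i' : i.+1 < #|porbit s x| by apply: ltn_trans lt_k.
rewrite expgSr permM IHi 1?ltnW // permM (expgSr _ i.+1) permM tpermD //.
  by rewrite eq_sym -(porbit_index0 s) porbit_index_exp.
by apply/eqP=> /(congr1 (porbit_index s x)); rewrite !porbit_index_exp //; lia.
Qed.

(** The exponents run from 1 to [k], so the last element listed is [s^k x] itself. *)
Lemma porbit_tperm_cut s x k : 0 < k < #|porbit s x| ->
  porbit (tperm x ((s ^+ k) x) * s) ((s ^+ k) x) =
    [set (s ^+ (val i).+1) x | i : 'I_k].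
Proof.
case/andP=> k0 lt_k; set y := (s ^+ k) x; set u := _ * s.
have E i : i < k -> (u ^+ i.+1) y = (s ^+ i.+1) x by apply: exp_tperm_cut.
have uk : (u ^+ k) y = y by rewrite -{1}(prednK k0) E ?prednK.
apply/setP=> z; apply/idP/imsetP => [|[i _ ->]]; last by rewrite -E ?mem_porbit /=.
case/porbitP=> n ->; elim: n => [|n [i _ IHn]].
  have lt_k1 : k.-1 < k by rewrite prednK.
  by exists (Ordinal lt_k1); rewrite //= prednK // expg0 perm1.
rewrite expgSr permM IHn -E //= -permM -expgSr.
have := ltn_ord i; rewrite leq_eqVlt => /predU1P[->|lt_i].
  exists (Ordinal k0) => //.
  by rewrite -E //= expgS permM -permM -expgS expgSr permM uk expg1.
by exists (Ordinal lt_i) => //; rewrite E.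
Qed.

Lemma card_porbit_tperm_cut s x k : 0 < k < #|porbit s x| ->
  #|porbit (tperm x ((s ^+ k) x) * s) ((s ^+ k) x)| = k.
Proof.
move=> hk; rewrite porbit_tperm_cut // card_in_imset ?card_ord // => i j _ _.
have [_ lt_k] := andP hk.
rewrite !expgSr !permM => /perm_inj /(congr1 (porbit_index s x)).
by rewrite !porbit_index_exp ?(ltn_trans (ltn_ord _)) // => /val_inj.
Qed.

Lemma porbit_tperm_split s x y : x != y -> y \in porbit s x ->
  y \notin porbit (tperm x y * s) x /\
  porbit s x = porbit (tperm x y * s) x :|: porbit (tperm x y * s) y.
Proof.
move=> neq_xy sxy; split.
  (* The first multiplication by [tperm x y] adds an orbit and the second restores [s], so it must
     merge two orbits: [x] and [y] are separated in between. *)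
  have /= := porbits_mul_tperm s x y.
  have /= := porbits_mul_tperm (tperm x y * s) x y.
  rewrite tpermKg (porbit_sym s) sxy (porbit_sym _ x) neq_xy.
  by case: (y \in _) => //=; lia.
set k := porbit_index s x y; set l := #|porbit s x|.
have Dy : y = (s ^+ k) x by rewrite porbit_indexK.
have k0 : 0 < k by rewrite lt0n porbit_index0 eq_sym.
have lt_k : k < l by rewrite porbit_index_lt.
(* With the roles of [x] and [y] exchanged, the same cut describes the other piece. *)
have Dx : x = (s ^+ (l - k)) y.
  by rewrite Dy -permM -expgD subnKC ?porbit_exp_card // ltnW.
have ly : #|porbit s y| = l by rewrite (porbit_eq sxy).
have Oy : porbit (tperm x y * s) y = [set (s ^+ (val i).+1) x | i : 'I_k].
  by rewrite {1 2}Dy porbit_tperm_cut ?k0.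
have Ox : porbit (tperm x y * s) x = [set (s ^+ (val i).+1) y | i : 'I_(l - k)].
  by rewrite tpermC {1 2}Dx porbit_tperm_cut // ly; lia.
apply/setP=> z; rewrite inE; apply/idP/orP => [sxz | []]; last 2 first.
- by rewrite Ox => /imsetP[i _ ->]; rewrite Dy -permM -expgD mem_porbit.
- by rewrite Oy => /imsetP[i _ ->]; rewrite mem_porbit.
(* Indexing from [s x] instead of [x] yields exponents in the form [i.+1], as in the two image
   sets. *)
have [i lt_i <-] : exists2 i, i < l & (s ^+ i.+1) x = z.
  have /porbit_indexK <- : z \in porbit s (s x).
    by rewrite (@porbit_eq s x) // (mem_porbit s 1).
  exists (porbit_index s (s x) z); last by rewrite expgS permM.
  have -> : l = #|porbit s (s x)| by rewrite (@porbit_eq s x) // (mem_porbit s 1).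
  by rewrite porbit_index_lt (@porbit_eq s x) // (mem_porbit s 1).
case: (ltnP i k) => [lt_ik | le_ki]; [right | left].
  by rewrite Oy; apply/imsetP; exists (Ordinal lt_ik).
have lt_ilk : i - k < l - k by lia.
rewrite Ox; apply/imsetP; exists (Ordinal lt_ilk) => //=.
by rewrite Dy -permM -expgD; congr ((s ^+ _) x); lia.
Qed.

(** This is the split of the product [tperm x y * s], which a second multiplication by [tperm x y]
    turns back into [s]; orbit counts show that the product joins [x] and [y]. *)
Lemma porbit_tperm_merge s x y : y \notin porbit s x ->
  porbit (tperm x y * s) x = porbit s x :|: porbit s y.
Proof.
move=> sxy; have neq_xy : x != y.
  by apply: contraNneq sxy => <-; exact: porbit_id.
have [|_] := @porbit_tperm_split (tperm x y * s) x y neq_xy; last by rewrite tpermKg.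
have /= := porbits_mul_tperm s x y.
have /= := porbits_mul_tperm (tperm x y * s) x y.
rewrite tpermKg (porbit_sym s) sxy (porbit_sym _ x) neq_xy.
by case: (y \in _) => //=; lia.
Qed.

(** * Orbits and conjugacy *)

Lemma porbit_conjg s u x : porbit (s ^ u) (u x) = u @: porbit s x.
Proof.
have E i : ((s ^ u) ^+ i) (u x) = u ((s ^+ i) x) by rewrite -conjXg permJ.
apply/setP=> y; apply/porbitP/imsetP => [[i ->] | [z /porbitP[i ->] ->]].
  by exists ((s ^+ i) x); rewrite ?mem_porbit.
by exists i.
Qed.

Lemma card_porbits_conjg s u : #|porbits (s ^ u)| = #|porbits s|.
Proof.
rewrite -(card_imset (porbits s) (imset_inj (@perm_inj _ u))).
congr #|pred_of_set _|; apply/setP=> O; apply/imsetP/imsetP.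
  case=> x _ ->; exists (porbit s (u^-1 x)); first by apply: imset_f.
  by rewrite -porbit_conjg permKV.
by case=> _ /imsetP[x _ ->] ->; exists (u x); rewrite ?porbit_conjg.
Qed.

(** A finer invariant than the number of orbits, for the case where one split and one merge leave
    that number unchanged. *)
Lemma card_porbit_size_conjg s u k :
  #|[set x | #|porbit (s ^ u) x| == k]| = #|[set x | #|porbit s x| == k]|.
Proof.
rewrite -(card_imset [set x | #|porbit s x| == k] (@perm_inj _ u)).
congr #|pred_of_set _|; apply/setP=> x.
rewrite -(permKV u x) mem_imset; last exact: perm_inj.
by rewrite !inE porbit_conjg card_imset //; exact: perm_inj.
Qed.

(* The conjugator sends [s^i r], for [r] a chosen representative of its
   [s]-orbit, to [u^i (g r)]. *)
Lemma conjg_of_porbit_map s u (g : T -> T) :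
  (forall x, #|porbit u (g x)| = #|porbit s x|) ->
  (forall x y, porbit u (g x) = porbit u (g y) -> porbit s x = porbit s y) ->
  u \in s ^: [set: {perm T}].
Proof.
move=> gcard ginj.
(* The default [x] is never taken, since the orbit contains [x]. *)
pose r x := odflt x [pick y in porbit s x].
have sr x : x \in porbit s (r x).
  rewrite /r; case: pickP => [y|] /=; first by rewrite porbit_sym.
  by rewrite porbit_id.
have req x y : porbit s x = porbit s y -> r x = r y.
  move=> sxy; rewrite /r -sxy.
  by case: pickP => //= /(_ x); rewrite porbit_id.
pose ix x := porbit_index s (r x) x.
have ixK x : (s ^+ ix x) (r x) = x by exact: porbit_indexK.
have ix_lt x : ix x < #|porbit u (g (r x))| by rewrite gcard porbit_index_lt.
pose h x := (u ^+ ix x) (g (r x)).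
have hinj : injective h.
  move=> x y hxy; have /ginj : porbit u (g (r x)) = porbit u (g (r y)).
    by rewrite -(porbit_perm u (ix x)) -/(h x) hxy porbit_perm.
  rewrite -(porbit_eq (sr x)) -(porbit_eq (sr y)) => /req rxy.
  move: (ix_lt y) (congr1 (porbit_index u (g (r x))) hxy).
  rewrite /h -rxy => lty; rewrite !porbit_index_exp // => ixy.
  by rewrite -(ixK x) -(ixK y) -rxy ixy.
have hJ x : h (s x) = u (h x).
  have rs : r (s x) = r x by apply: req; rewrite (porbit_perm s 1).
  have sx : s x = (s ^+ (ix x).+1) (r x) by rewrite expgSr permM ixK.
  have ux : u (h x) = (u ^+ (ix x).+1) (g (r x)) by rewrite expgSr permM.
  (* Either [x] is last on its orbit and both [s] and [u] wrap around to the representatives, or the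
     position just increases by one. *)
  have := ix_lt x; rewrite gcard leq_eqVlt => /predU1P[lx | lt_i].
    have -> : u (h x) = g (r x) by rewrite ux lx -gcard porbit_exp_card.
    have -> : s x = r x by rewrite sx lx porbit_exp_card.
    have rr : r (r x) = r x by apply/req/esym/porbit_eq.
    have /eqP ix0 : ix (r x) == 0 by rewrite /ix rr porbit_index0.
    by rewrite /h rr ix0 expg0 perm1.
  by rewrite ux /h /ix rs {1}sx porbit_index_exp.
apply/imsetP; exists (perm hinj); rewrite ?inE //.
apply/permP=> y; rewrite -(permKV (perm hinj) y); move: (_ y) => z.
by rewrite permJ !permE hJ.
Qed.

(** * Which triples give a conjugate permutation *)

(** Both sides are the 3-cycle sending [a] to [b], [b] to [c] and [c] to [a]. *)
Lemma tperm3_rot a b c : a != b -> b != c -> a != c ->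
  tperm a b * tperm a c = tperm b c * tperm b a.
Proof.
move=> ab bc ac; apply/permP=> x; rewrite !permM.
by do ![case: tpermP => //]; move=> *; subst; rewrite ?eqxx in ab bc ac.
Qed.

(** Both transpositions merge, so the number of orbits drops by two. *)
Lemma merge_not_conjg s a b c : a != b -> b != c -> a != c ->
    b \notin porbit s a -> c \notin porbit s a -> c \notin porbit s b ->
  tperm a b * (tperm a c * s) \notin s ^: [set: {perm T}].
Proof.
move=> ab bc ac sab sac sbc; apply/negP=> /imsetP[v _ E].
have := card_porbits_conjg s v; rewrite -E.
have /= := porbits_mul_tperm s a c.
have /= := porbits_mul_tperm (tperm a c * s) a b.
rewrite ![a \in _]porbit_sym sac porbit_tperm_merge // inE (negPf sab).
rewrite (porbit_sym s) sbc ab ac /=.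
lia.
Qed.

(** The transposition of [a] and [c] cuts the cycle into the piece from [s a] to [c] and the piece
    ending at [a]. The second transposition glues them back exactly when [b] lies in the first
    piece; otherwise it splits again. *)
Lemma split_conjg s a b c : a != b -> b != c -> a != c ->
    b \in porbit s a -> c \in porbit s a ->
  (tperm a b * (tperm a c * s) \in s ^: [set: {perm T}]) =
    (porbit_index s a b < porbit_index s a c).
Proof.
move=> ab bc ac sab sac.
set k := porbit_index s a c; set t := tperm a c * s.
have Dc : c = (s ^+ k) a by rewrite porbit_indexK.
have [tac tO] := porbit_tperm_split ac sac; rewrite -/t in tac tO.
have hk : 0 < k < #|porbit s a|.
  by rewrite lt0n porbit_index0 eq_sym ac porbit_index_lt.
have tc : porbit t c = [set (s ^+ (val i).+1) a | i : 'I_k].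
  by rewrite /t {1 2}Dc porbit_tperm_cut.
have -> : (porbit_index s a b < k) = (b \notin porbit t a).
  have -> : (b \notin porbit t a) = (b \in porbit t c).
    have := sab; rewrite tO inE => /orP[tab | tcb].
      rewrite tab; apply/esym/negbTE; apply: contra tac => tcb.
      by rewrite -(porbit_eq tab) (porbit_eq tcb) porbit_id.
    rewrite tcb; apply: contra tac => tab.
    by rewrite -(porbit_eq tab) (porbit_eq tcb) porbit_id.
  rewrite tc; apply/idP/imsetP => [lt_b | [i _ Db]].
    have b0 : 0 < porbit_index s a b by rewrite lt0n porbit_index0 eq_sym.
    have lt_b1 : (porbit_index s a b).-1 < k by lia.
    by exists (Ordinal lt_b1); rewrite //= prednK // porbit_indexK.
  move: Db (ltn_ord i) => /=; move: (nat_of_ord i) => j Db lt_j.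
  have : j.+1 != k by apply: contraNneq bc => jk; rewrite Db jk -Dc.
  by rewrite Db porbit_index_exp; lia.
apply/idP/idP => [/imsetP[v _ E] | tab].
  (* Two splits would raise the number of orbits by two. *)
  apply/negP=> tab; have := card_porbits_conjg s v; rewrite -E.
  have /= := porbits_mul_tperm s a c.
  have /= := porbits_mul_tperm t a b.
  by rewrite -/t ![a \in _]porbit_sym sac tab ab ac /=; lia.
have tcb : porbit t b = porbit t c.
  by apply: porbit_eq; move: sab; rewrite tO inE (negPf tab).
have uE x : porbit (tperm a b * t) x = porbit s x.
  have ua : porbit (tperm a b * t) a = porbit s a.
    by rewrite porbit_tperm_merge // tcb tO.
  case: (boolP (x \in porbit s a)) => [sax | sax].
    by rewrite (porbit_eq sax) -ua; apply: porbit_eq; rewrite ua.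
  have sxO y : y \in porbit s a -> y \notin porbit s x.
    by move=> sy; rewrite porbit_sym (porbit_eq sy).
  have tx : porbit t x = porbit s x by rewrite /t porbit_tperm_out ?sxO ?porbit_id.
  by rewrite porbit_tperm_out // tx sxO ?porbit_id.
(* All orbits are those of [s], so the identity matches them. *)
by apply: (conjg_of_porbit_map (g := id)) => [x | x y]; rewrite !uE.
Qed.

(** After rotating the 3-cycle, the orbit of [b] is first cut into lengths [k] (with [a]) and
    [l - k] (with [b]), and the latter is glued to the orbit of [c]. Lengths [l], [m] become [k],
    [l - k + m]; as [k < l], the cycle type survives only if [k = m]. *)
Lemma split_merge_conjg s a b c : a != b -> b != c -> a != c ->
    b \in porbit s a -> c \notin porbit s a ->
  (tperm a b * (tperm a c * s) \in s ^: [set: {perm T}]) =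
    (#|porbit s c| < #|porbit s b|) && (a == (s ^+ #|porbit s c|) b).
Proof.
move=> ab bc ac sab sac; rewrite mulgA tperm3_rot // -mulgA.
have sba : a \in porbit s b by rewrite porbit_sym.
have O_ab := porbit_eq sab; rewrite -O_ab in sac.
set m := #|porbit s c|; set l := #|porbit s b|.
set k := porbit_index s b a; set t := tperm b a * s; set u := tperm b c * t.
have Da : a = (s ^+ k) b by rewrite porbit_indexK.
have hk : 0 < k < l.
  by rewrite lt0n porbit_index0 ab porbit_index_lt.
have [k0 lt_k] := andP hk.
have neq_ba : b != a by rewrite eq_sym.
have [tba tO] := porbit_tperm_split neq_ba sba; rewrite -/t in tba tO.
have ta : #|porbit t a| = k by rewrite /t Da card_porbit_tperm_cut.
have tb : #|porbit t b| = l - k.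
  by rewrite /l tO cardsU disjoint_setI0 ?disjoint_porbit // cards0 subn0 ta addnK.
have sOut x y : x \notin porbit s b -> y \in porbit s b -> y \notin porbit s x.
  by move=> sx sy; rewrite porbit_sym (porbit_eq sy).
have tout x : x \notin porbit s b -> porbit t x = porbit s x.
  by move=> sbx; rewrite /t porbit_tperm_out // sOut ?porbit_id.
have tc : porbit t c = porbit s c by exact: tout.
have tbc : c \notin porbit t b.
  by apply: contra sac => tbc; rewrite tO inE tbc.
have ub : porbit u b = porbit t b :|: porbit s c.
  by rewrite /u porbit_tperm_merge ?tc.
have ubc : #|porbit u b| = l - k + m.
  by rewrite ub -tc cardsU disjoint_setI0 ?disjoint_porbit // cards0 subn0 tb tc.
have ua : porbit u a = porbit t a.
  rewrite /u porbit_tperm_out // 1?porbit_sym //.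
  by rewrite tc sOut.
have uout x : x \notin porbit s b -> x \notin porbit s c -> porbit u x = porbit s x.
  by move=> xb xc; rewrite /u porbit_tperm_out tout // porbit_sym.
have fl x : x \in porbit s b -> #|porbit s x| = l by move/porbit_eq->.
have fm x : x \in porbit s c -> #|porbit s x| = m by move/porbit_eq->.
apply/imsetP/andP => [[v _ E] | [lt_m /eqP Dam]].
  suff km : k = m by rewrite -km -Da.
  (* If [k] differs from [m], every point on an [s]-cycle of length [k] is off the orbits of [b] and
     [c] and keeps its orbit, while [a] newly joins a cycle of length [k]. *)
  apply: contraTeq isT => neq_km; have := card_porbit_size_conjg s v k.
  rewrite -E -/u => /eqP; rewrite eq_sym => /eqP sz.
  have : [set x | #|porbit s x| == k] \proper [set x | #|porbit u x| == k].
    apply/properP; split; last first.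
      by exists a; rewrite inE ?ua ?ta // fl // gtn_eqF.
    apply/subsetP=> x; rewrite !inE => /eqP fx; rewrite uout ?fx //.
      by apply: contraL isT => /fl; lia.
    by apply: contraL isT => /fm; lia.
  by move/proper_card; rewrite sz ltnn.
have km : k = m by rewrite /k Dam porbit_index_exp.
have fub : #|porbit u b| = l by rewrite ubc; lia.
have fua : #|porbit u a| = m by rewrite ua ta.
(* In [u], the orbit of [b] has length [l] and that of [a] has length [m]; they replace the
   [s]-orbits of [b] and [c] respectively. *)
pose g x := if x \in porbit s b then b else if x \in porbit s c then a else x.
apply/imsetP; apply: (conjg_of_porbit_map (g := g)) => [x | x y]; rewrite /g.
  case: ifPn => [/fl-> // | xb]; case: ifPn => [/fm-> // | xc].
  by rewrite uout.
have ba : porbit u b <> porbit u a by move/(congr1 (fun A : {set T} => #|A|)); lia.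
have bO z : z \notin porbit s b -> z \notin porbit s c -> porbit u b <> porbit u z.
  by move=> zb zc /setP/(_ b); rewrite porbit_id uout // porbit_sym (negPf zb).
have aO z : z \notin porbit s b -> z \notin porbit s c -> porbit u a <> porbit u z.
  move=> zb zc /setP/(_ a); rewrite porbit_id uout // porbit_sym.
  by rewrite (porbit_eq sba) (negPf zb).
case: ifPn => [/porbit_eq-> | xb]; last case: ifPn => [/porbit_eq-> | xc];
  (case: ifPn => [/porbit_eq-> // | yb]; last case: ifPn => [/porbit_eq-> // | yc]) => //.
- by move/bO=> [].
- by move/esym.
- by move/aO=> [].
- by move/esym/bO=> [].
- by move/esym/aO=> [].
by rewrite !uout.
Qed.

(** An index below the orbit size certifies membership, so the bounds also place [b] and [c] on the
    orbit of [a]. *)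
Definition cyclic_triple s a b c :=
  (0 < porbit_index s a b < porbit_index s a c)
  && (porbit_index s a c < #|porbit s a|).

(** The equation places [a] on the orbit of [b], and the strict inequality keeps [c] off it. *)
Definition bridging_triple s a b c :=
  (#|porbit s c| < #|porbit s b|) && (a == (s ^+ #|porbit s c|) b).

(** The product sends [a], [b], [c] to [s b], [s c], [s a] and agrees with [s] elsewhere. *)
Definition good_triple s a b c :=
  [&& a != b, b != c, a != c & tperm a b * (tperm a c * s) \in s ^: [set: {perm T}]].

Lemma good_triple_rot s a b c : good_triple s b c a = good_triple s a b c.
Proof.
rewrite /good_triple !mulgA [c == a]eq_sym [b == a]eq_sym.
case: (eqVneq a b) => [-> | ab] /=; first by rewrite !andbF.
case: (eqVneq a c) => [-> | ac] /=; first by rewrite !andbF.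
case: (eqVneq b c) => [-> | bc] //=; rewrite -tperm3_rot //.
Qed.

Lemma cyclic_triple_porbit s a b c : cyclic_triple s a b c ->
  [/\ a != b, b != c, a != c, b \in porbit s a & c \in porbit s a].
Proof.
case/andP=> /andP[b0 bc] ca; have bl := ltn_trans bc ca.
split; rewrite -?porbit_index_lt //.
- by rewrite eq_sym -(porbit_index0 s) -lt0n.
- by apply: contraTneq bc => ->; rewrite ltnn.
by rewrite eq_sym -(porbit_index0 s) -lt0n (ltn_trans b0).
Qed.

Lemma bridging_triple_porbit s a b c : bridging_triple s a b c ->
  [/\ a != b, b != c, a != c, b \in porbit s a & c \notin porbit s a].
Proof.
case/andP=> lt_cb /eqP Da; have sba : a \in porbit s b by rewrite Da mem_porbit.
have sac : c \notin porbit s a.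
  by apply: contraTN lt_cb => sac; rewrite (porbit_eq sac) (porbit_eq sba) ltnn.
rewrite porbit_sym; split => //.
- by rewrite -(porbit_index0 s) Da porbit_index_exp // card_porbit_neq0.
- by apply: contraTneq lt_cb => ->; rewrite ltnn.
by apply: contraNneq sac => <-; exact: porbit_id.
Qed.

(** Stated in numbers so that it can be summed, which also makes the four situations exclusive. The
    cases are: one common orbit, exactly one pair sharing an orbit (rotated to the front), or three
    distinct orbits. *)
Lemma good_tripleE s a b c :
  good_triple s a b c = cyclic_triple s a b c + (bridging_triple s a b c +
    bridging_triple s b c a + bridging_triple s c a b) :> nat.
Proof.
case: (boolP [&& a != b, b != c & a != c]) => [/and3P[ab bc ac] | ndist]; last first.
  have [-> -> -> -> ->] : [/\ good_triple s a b c = false,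
      cyclic_triple s a b c = false, bridging_triple s a b c = false,
      bridging_triple s b c a = false & bridging_triple s c a b = false].
    split; apply: contraNF ndist.
    - by case/and4P=> -> -> ->.
    - by case/cyclic_triple_porbit=> -> -> ->.
    - by case/bridging_triple_porbit=> -> -> ->.
    - by case/bridging_triple_porbit=> bc ca ba _ _; rewrite bc eq_sym ba eq_sym ca.
    by case/bridging_triple_porbit=> ca ab cb _ _; rewrite ab eq_sym cb eq_sym ca.
  by [].
have Bout x y z : (z \in porbit s x) || (y \notin porbit s x) ->
    bridging_triple s x y z = false.
  by move=> h; apply: contraTF h => /bridging_triple_porbit[_ _ _ -> /negPf->].
have Bsplit x y z : x != y -> y != z -> x != z ->
    y \in porbit s x -> z \notin porbit s x ->
    good_triple s x y z = bridging_triple s x y z.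
  by move=> xy yz xz sy sz; rewrite /good_triple xy yz xz split_merge_conjg.
have Aout : (b \notin porbit s a) || (c \notin porbit s a) ->
    cyclic_triple s a b c = false.
  by move=> h; apply: contraTF h => /cyclic_triple_porbit[_ _ _ -> ->].
case: (boolP (b \in porbit s a)) => sb; case: (boolP (c \in porbit s a)) => sc.
- rewrite !Bout ?(porbit_eq sb) ?(porbit_eq sc) ?porbit_id ?sb ?sc // !addn0.
  rewrite /good_triple ab bc ac split_conjg //= /cyclic_triple.
  by rewrite porbit_index_lt sc andbT lt0n porbit_index0 eq_sym ab.
- rewrite Aout ?sc ?orbT // (Bout b c a) ?(Bout c a b);
    rewrite ?(porbit_eq sb) ?porbit_id ?sc ?orbT //.
    by rewrite Bsplit // addn0 add0n addn0.
  by rewrite [a \in _]porbit_sym sc orbT.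
- rewrite Aout ?sb // (Bout a b c) ?(Bout b c a) ?sc //.
    (* Two rotations bring the pair [c], [a] to the front. *)
    rewrite -good_triple_rot -good_triple_rot.
    by rewrite Bsplit ?(porbit_eq sc) ?porbit_id // eq_sym.
  by rewrite [c \in _]porbit_sym (porbit_eq sc) sb orbT.
rewrite Aout ?sb // (Bout a b c) ?sb ?orbT //.
rewrite (Bout c a b) ?[a \in _]porbit_sym ?sc ?orbT //.
rewrite add0n addn0 -good_triple_rot.
case: (boolP (c \in porbit s b)) => sbc.
  by rewrite Bsplit // 1?eq_sym // porbit_sym.
rewrite Bout ?sbc ?orbT // good_triple_rot /good_triple ab bc ac /=.
by rewrite (negPf (merge_not_conjg _ _ _ _ _ _)).
Qed.

(** * Counting triples *)

Lemma sum_bridging_triple s :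
  \sum_a \sum_b \sum_c bridging_triple s a b c =
    \sum_b \sum_c (#|porbit s c| < #|porbit s b|).
Proof.
rewrite exchange_big; apply: eq_bigr => b _ /=.
rewrite exchange_big; apply: eq_bigr => c _ /=.
rewrite (bigD1 ((s ^+ #|porbit s c|) b)) //= /bridging_triple eqxx andbT.
by rewrite big1 ?addn0 // => a /negPf->; rewrite andbF.
Qed.

(** Once [a] is fixed, [b] and [c] occupy two of the remaining positions of its cycle, in increasing
    order. *)
Lemma sum_cyclic_triple s :
  \sum_a \sum_b \sum_c cyclic_triple s a b c = \sum_a 'C(#|porbit s a|.-1, 2).
Proof.
apply: eq_bigr => a _; rewrite exchange_big /=.
rewrite (bigID [pred c | c \in porbit s a]) /= [X in _ + X]big1 ?addn0; last first.
  move=> c sac; rewrite big1 // => b _; case E: (cyclic_triple _ _ _ _) => //.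
  by case/cyclic_triple_porbit: E => _ _ _ _; rewrite (negPf sac).
rewrite big_porbit; set l := #|porbit s a|.
(* With [c] at position [j], [b] takes any position strictly between 0 and [j]; the truncated
   predecessor also covers [j = 0]. *)
have E (j : 'I_l) : \sum_b cyclic_triple s a b ((s ^+ j) a) = j.-1.
  rewrite (bigID [pred b | b \in porbit s a]) /= [X in _ + X]big1 ?addn0; last first.
    move=> b sab; case E: (cyclic_triple _ _ _ _) => //.
    by case/cyclic_triple_porbit: E => _ _ _; rewrite (negPf sab).
  rewrite big_porbit -/l.
  transitivity (\sum_(i < l) (0 < i < j)).
    by apply: eq_bigr => i _; rewrite /cyclic_triple !porbit_index_exp // ltn_ord andbT.
  rewrite -(big_mkord xpredT (fun i => nat_of_bool (0 < i < j))).
  rewrite (big_cat_nat (n := j)) //=; last exact/ltnW/ltn_ord.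
  rewrite [X in _ + X]big_nat [X in _ + X]big1 ?addn0; last by move=> i; lia.
  case: (nat_of_ord j) => [|k]; first by rewrite big_nil.
  rewrite big_nat_recl //= add0n (@eq_big_nat _ _ _ _ _ _ (fun=> 1%N)); last first.
    by move=> i; lia.
  by rewrite sum_nat_const_nat; lia.
rewrite (eq_bigr _ (fun j _ => E j)) -(big_mkord xpredT predn).
have : 0 < l by exact: card_porbit_gt0.
by case: (l) => // l' _; rewrite big_nat_recl //= add0n bin2_sum.
Qed.

(** * From triples to conjugates at distance 3 *)

Definition class_at_distance3 s :=
  [set u in s ^: [set: {perm T}] | #|[set x | u x != s x]| == 3].

(** Good triples correspond to pairs of a conjugate [u] and a marked point [a] where it differs from
    [s]; each [u] has three such points. *)
Lemma card_good_triples s :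
  \sum_a \sum_b \sum_c good_triple s a b c = (#|class_at_distance3 s| * 3)%N.
Proof.
transitivity (\sum_(u in class_at_distance3 s) \sum_a (u a != s a)); last first.
  rewrite -sum_nat_const; apply: eq_bigr => u.
  by rewrite inE => /andP[_ /eqP <-]; rewrite -sum1dep_card [RHS]big_mkcond.
rewrite [RHS]exchange_big /=; apply: eq_bigr => a _.
pose f (p : T * T) := tperm a p.1 * (tperm a p.2 * s).
pose P := [set p : T * T | good_triple s a p.1 p.2].
pose Q := [set u in class_at_distance3 s | u a != s a].
transitivity #|P|.
  by rewrite pair_big -sum1dep_card [RHS]big_mkcond.
transitivity #|Q|; last by rewrite -sum1dep_card big_mkcondr.
have fE b c : a != b -> b != c -> a != c ->
    [/\ f (b, c) a = s b, f (b, c) b = s c, f (b, c) c = s a &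
        forall x, x != a -> x != b -> x != c -> f (b, c) x = s x].
  move=> ab bc ac; rewrite /f /= !permM tpermL tpermR; split.
  - by rewrite tpermD // eq_sym.
  - by rewrite tpermL.
  - by rewrite (tpermD ac bc) tpermR.
  move=> x xa xb xc.
  by rewrite !permM (tpermD (z := x)) 1?eq_sym // tpermD // eq_sym.
have finj : {in P &, injective f}.
  move=> [b c] [b' c']; rewrite !inE => /and4P[/= ab bc ac _] /and4P[/= ab' bc' ac' _] ff.
  have [fa fb _ _] := fE b c ab bc ac; have [fa' fb' _ _] := fE b' c' ab' bc' ac'.
  have Eb : b = b' by apply: (@perm_inj _ s); rewrite -fa -fa' ff.
  by congr (_, _) => //; apply: (@perm_inj _ s); rewrite -fb -fb' ff Eb.
rewrite -(card_in_imset finj); congr #|pred_of_set _|; apply/setP=> u.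
rewrite !inE; apply/imsetP/andP => [[[b c]] | [/andP[us /eqP u3] ua]].
  rewrite inE => /and4P[/= ab bc ac us] ->.
  have [fa fb fc fout] := fE b c ab bc ac.
  split; last by rewrite fa (inj_eq perm_inj) eq_sym.
  rewrite us /=; apply/eqP; transitivity #|[set a; b; c]|.
    congr #|pred_of_set _|; apply/setP=> x; rewrite !inE.
    case: (eqVneq x a) => [->|xa]; first by rewrite fa (inj_eq perm_inj) eq_sym.
    case: (eqVneq x b) => [->|xb]; first by rewrite fb (inj_eq perm_inj) eq_sym.
    case: (eqVneq x c) => [->|xc]; first by rewrite fc (inj_eq perm_inj).
    by rewrite fout // eqxx.
  by rewrite -setUA cardsU1 cards2 !inE negb_or ab ac bc.
(* The candidate 3-cycle: [u] is [k] followed by [s], and the triple is recovered as [a], [k a],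
   [k (k a)]. *)
pose k := u * s^-1.
have kE x : s (k x) = u x by rewrite /k permM permKV.
have supp x : (u x != s x) = (k x != x) by rewrite -kE (inj_eq perm_inj).
pose M := [set x | k x != x].
have M3 : #|M| = 3.
  by rewrite -u3; congr #|pred_of_set _|; apply/setP=> x; rewrite !inE supp.
have Mk x : (k x \in M) = (x \in M) by rewrite !inE (inj_eq perm_inj).
pose b := k a; pose c := k b.
have Ma : a \in M by rewrite inE -supp.
have Mb : b \in M by rewrite Mk.
have Mc : c \in M by rewrite Mk.
have ab : a != b by move: Ma; rewrite inE eq_sym.
have bc : b != c by move: Mb; rewrite inE eq_sym.
have ac : a != c.
  (* If [k] swapped [a] and [b], it would fix the third moved point [d], the only one left. *)
  apply/eqP=> ac; have /eqP/cards1P[d Md] : #|M :\ a :\ b| = 1%N.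
    move: M3; rewrite (cardsD1 a M) Ma (cardsD1 b (M :\ a)).
    by rewrite in_setD1 eq_sym ab Mb /= => -[].
  have : d \in M :\ a :\ b by rewrite Md set11.
  rewrite !in_setD1 => /and3P[db da dM].
  have : k d \in M :\ a :\ b.
    rewrite !in_setD1 Mk dM andbT; apply/andP; split.
      by rewrite (inj_eq perm_inj).
    by rewrite ac (inj_eq perm_inj).
  by move: dM; rewrite Md !inE => /negPf->.
have MD : M = [set a; b; c].
  apply/esym/eqP; rewrite eqEcard M3 !subUset !sub1set Ma Mb Mc /=.
  by rewrite -setUA cardsU1 cards2 !inE negb_or ab ac bc.
have kc : k c = a.
  have : k c \in M by rewrite Mk.
  rewrite MD !inE -orbA => /or3P[/eqP // | /eqP kc | /eqP kc].
    by case/eqP: ac; apply: (@perm_inj _ k); rewrite kc.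
  by case/eqP: bc; apply: (@perm_inj _ k); rewrite kc.
have uf : u = f (b, c).
  have [fa fb fc fout] := fE b c ab bc ac; apply/permP=> x; rewrite -kE.
  case: (eqVneq x a) => [->|xa]; first by rewrite fa.
  case: (eqVneq x b) => [->|xb]; first by rewrite fb.
  case: (eqVneq x c) => [->|xc]; first by rewrite fc kc.
  rewrite fout //; congr (s _); apply/eqP; apply: contraTT isT => kx.
  have : x \in M by rewrite inE.
  by rewrite MD !inE (negPf xa) (negPf xb) (negPf xc).
by exists (b, c); rewrite // inE /good_triple /= ab bc ac; rewrite uf in us.
Qed.

End PermutationOrbits.

(** * From conjugates to conjugating permutations *)

(** If [w] conjugates [s] to [u], the fibre is the right coset of the centralizer through [w]. *)
Lemma card_conjg_fiber (T : finType) (s u : {perm T}) :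
  u \in (s ^: [set: {perm T}])%g ->
  #|[set v : {perm T} | (s ^ v)%g == u]| = #|('C[s])%g|.
Proof.
case/imsetP=> w _ ->; rewrite -(card_rcoset 'C[s]%g w).
congr #|pred_of_set _|; apply/setP=> v; rewrite inE mem_rcoset.
rewrite -(inj_eq (conjg_inj (w^-1)%g)) conjgK -conjgM.
by apply/eqP/cent1P=> [/conjg_fixP/commgP/commute_sym// | /commute_sym/commgP/conjg_fixP].
Qed.

Lemma num_3_commuting (n : nat) (beta : 'S_n) :
  num_k_commuting 3 beta = #|class_at_distance3 beta| * #|('C[beta])%g|.
Proof.
(* The bijection [alpha] carries the points where the two products differ onto those where
   [beta ^ alpha] and [beta] differ. *)
have hE alpha : hamming (perm_comp alpha beta) (perm_comp beta alpha) =
    #|[set x | (beta ^ alpha)%g x != beta x]|.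
  rewrite /hamming -(card_imset [set a | _] (@perm_inj _ alpha)).
  congr #|pred_of_set _|; apply/setP=> x.
  rewrite -(permKV alpha x) mem_imset; last exact: perm_inj.
  by rewrite !inE permJ !perm_compE.
rewrite /num_k_commuting -sum1_card.
rewrite (partition_big (fun alpha => beta ^ alpha)%g
  (mem (class_at_distance3 beta))) /=; last first.
  by move=> alpha; rewrite !inE hE => ->; rewrite memJ_class ?inE.
rewrite -sum_nat_const; apply: eq_bigr => u; rewrite inE => /andP[us /eqP u3].
rewrite -(card_conjg_fiber us) -sum1_card; apply: eq_bigl => alpha.
by rewrite !inE hE andbC; case: eqP => //= ->; rewrite u3 eqxx.
Qed.

(** * Sums over points in terms of the cycle type *)

Lemma sum_porbits (T : finType) (s : {perm T}) (H : nat -> nat) :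
  \sum_x H #|porbit s x| = \sum_(O in porbits s) #|O| * H #|O|.
Proof.
rewrite (partition_big_imset (porbit s)) /=; apply: eq_bigr => O /imsetP[y _ ->].
rewrite -sum_nat_const; apply: eq_big => [x | x /eqP-> //].
by rewrite eq_porbit_mem.
Qed.

Lemma sum_cycle_type (n : nat) (beta : 'S_n) (c : nat -> nat) (H : nat -> nat) :
  has_cycle_type beta c ->
  \sum_x H #|porbit beta x| = \sum_(1 <= l < n.+1) l * c l * H l.
Proof.
move=> hc; rewrite sum_porbits.
(* Each orbit size is exactly one [l] between 1 and [n], so an indicator can be inserted and the
   sums exchanged. *)
transitivity (\sum_(O in porbits beta) \sum_(1 <= l < n.+1) (#|O| == l) * (l * H l)).
  apply: eq_bigr => _ /imsetP[x _ ->].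
  have hx : 1 <= #|porbit beta x| < n.+1.
    by rewrite card_porbit_gt0 ltnS -[X in _ <= X]card_ord max_card.
  rewrite (bigD1_seq #|porbit beta x|) ?mem_index_iota ?iota_uniq //= eqxx mul1n.
  by rewrite big1 ?addn0 // => l; rewrite eq_sym => /negPf->.
rewrite exchange_big /= big_nat [RHS]big_nat; apply: eq_bigr => l hl.
rewrite -big_distrl /= -(hc l hl) -sum1dep_card big_mkcondr /=.
rewrite mulnA [_ * l]mulnC; congr (_ * _ * _).
Qed.

Theorem theorem5 (n : nat) (beta : 'S_n) (c : nat -> nat)
    (hc : has_cycle_type beta c) :
  num_k_commuting 3 beta =
    (\sum_(3 <= l < n.+1) c l * 'C(l, 3)
     + \sum_(1 <= l < n.+1) \sum_(l.+1 <= m < n.+1) l * m * c l * c m)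
    * #|('C[beta])%g|.
Proof.
rewrite num_3_commuting; congr (_ * _).
apply/eqP; rewrite -(eqn_pmul2r (isT : 0 < 3)) -card_good_triples; apply/eqP.
transitivity (\sum_a 'C(#|porbit beta a|.-1, 2)
    + 3 * \sum_b \sum_c (#|porbit beta c| < #|porbit beta b|)).
  rewrite -sum_cyclic_triple -sum_bridging_triple.
  under eq_bigr => a _ do
    under eq_bigr => b _ do under eq_bigr => x _ do rewrite good_tripleE.
  under eq_bigr => a _ do under eq_bigr => b _ do rewrite !big_split /=.
  under eq_bigr => a _ do rewrite !big_split /=.
  rewrite !big_split /=; congr (_ + _).
  (* Rotating the summation variables shows that the three bridging sums coincide, whence the factor
     3. *)
  have rot (F : 'I_n -> 'I_n -> 'I_n -> nat) :
      \sum_a \sum_b \sum_x F b x a = \sum_a \sum_b \sum_x F a b x.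
    by rewrite exchange_big /=; apply: eq_bigr => a _; rewrite exchange_big.
  rewrite -(rot (fun a b x => nat_of_bool (bridging_triple beta x a b))).
  rewrite (rot (fun a b x => nat_of_bool (bridging_triple beta a b x))).
  by rewrite !mulSn mul0n addn0 addnA.
rewrite [RHS]mulnC mulnDr; congr (_ + 3 * _).
  rewrite (sum_cycle_type (fun l => 'C(l.-1, 2)) hc).
  (* The terms at 1 and 2 vanish, and [l * 'C(l.-1, 2) = 3 * 'C(l, 3)] accounts for the rest. *)
  rewrite (@big_nat_widenl _ _ _ 3 1) // big_distrr /= [RHS]big_mkcond.
  apply: eq_bigr => l _; rewrite mulnAC mul_bin_diag [LHS]mulnAC -mulnA.
  by case: ltnP => // l3; rewrite bin_small ?muln0.
(* The outer variable becomes the point on the shorter cycle, matching [l < m] in the goal. *)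
rewrite exchange_big /=.
transitivity (\sum_x \sum_(1 <= m < n.+1) m * c m * (#|porbit beta x| < m)).
  apply: eq_bigr => x _.
  exact: (sum_cycle_type (fun m => nat_of_bool (#|porbit beta x| < m)) hc).
rewrite (sum_cycle_type (fun l => \sum_(1 <= m < n.+1) m * c m * (l < m)) hc).
apply: eq_bigr => l _.
rewrite (@big_nat_widenl _ _ _ l.+1 1) // big_distrr [RHS]big_mkcond /=.
by apply: eq_bigr => m _; case: ltnP => _; nia.
Qed.
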